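(* Let $A\in\mathbb{R}^{n\times n}$ be symmetric positive-definite, $b,x_0\in\mathbb{R}^n$, $x=A^{-1}b$, $r_0=b-Ax_0$. Let $k_{\max}\in\mathbb{N}^*$ and let $\Omega\in\mathbb{R}^{\ell\times n}$ be an $\epsilon$-embedding of $\mathcal{K}_{k_{\max}}=\mathrm{Span}\{r_0,Ar_0,\dots,A^{k_{\max}-1}r_0\}$, with $0<\epsilon<1$. Let $x_k,r_k,p_k,\gamma_k,\delta_k$ be the quantities produced in exact arithmetic by the arCG algorithm (described in the context). Assume that for some $\tilde\epsilon>0$ the computed coefficients satisfy, for all $k\le k_{\max}$, $$(1-\tilde\epsilon)\frac{\|r_k\|^2}{\langle p_k,Ap_k\rangle}\le\gamma_k\le(1+\tilde\epsilon)\frac{\|r_k\|^2}{\langle p_k,Ap_k\rangle},\qquad (1-\tilde\epsilon)\frac{\|r_k\|^2}{\|r_{k-1}\|^2}\le\delta_k\le(1+\tilde\epsilon)\frac{\|r_k\|^2}{\|r_{k-1}\|^2}$$ (the condition on $\delta_k$ being required for $k\ge1$). Let $k,d\in\mathbb{N}$ be such that $k+d\le k_{\max}$. Then $$\|x-x_k\|_A^2-\|x-x_{k+d}\|_A^2\le\frac{1+\tilde\epsilon+2\epsilon}{1-\epsilon}\sum_{j=k}^{k+d-1}|\gamma_j|\,\|\Omega p_j\|^2.$$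
   Context: $\langle\cdot,\cdot\rangle$, $\|\cdot\|$ are Euclidean and $\|z\|_A^2=\langle Az,z\rangle$. $\Omega$ is an $\epsilon$-embedding of a subspace $\mathcal{V}$ if $(1-\epsilon)\|z\|^2\le\|\Omega z\|^2\le(1+\epsilon)\|z\|^2$ for all $z\in\mathcal{V}$; equivalently $|\langle\Omega z,\Omega y\rangle-\langle z,y\rangle|\le\epsilon\|z\|\|y\|$ for all $z,y\in\mathcal{V}$. arCG algorithm (approximated through randomization conjugate gradient): set $r_0=b-Ax_0$, $p_0=r_0$. For $k=0,1,2,\dots$: if $k\ge1$, set $\delta_k=\|\Omega r_k\|^2/\|\Omega r_{k-1}\|^2$ and $p_k=r_k+\delta_kp_{k-1}$; then set $$\gamma_k=\frac{\|\Omega r_k\|^2}{\langle\Omega Ap_k,\Omega p_k\rangle},\qquad x_{k+1}=x_k+\gamma_kp_k,\qquad r_{k+1}=r_k-\gamma_kAp_k.$$ It is understood that the algorithm has not stopped and that all denominators are nonzero for the indices considered. *)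

(* Defs.v *)
From mathcomp Require Import all_boot all_order all_algebra.
From mathcomp Require Import reals.

Set Implicit Arguments.
Unset Strict Implicit.
Unset Printing Implicit Defensive.

Import Order.TTheory GRing.Theory Num.Theory.
Local Open Scope ring_scope.

Definition dot (R : realType) (n : nat) (u v : 'cV[R]_n) : R :=
  \sum_(i < n) u i 0 * v i 0.

Definition enorm (R : realType) (n : nat) (u : 'cV[R]_n) : R :=
  Num.sqrt (dot u u).

Definition sqnormA (R : realType) (n : nat) (A : 'M[R]_n) (z : 'cV[R]_n) : R :=
  dot (A *m z) z.

Definition sympd (R : realType) (n : nat) (A : 'M[R]_n) : Prop :=
  A^T = A /\ forall z : 'cV[R]_n, z != 0 -> 0 < dot (A *m z) z.

Definition krylov (R : realType) (n : nat) (A : 'M[R]_n) (r0 : 'cV[R]_n)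
    (m : nat) : {vspace 'cV[R]_n} :=
  <<[seq A ^+ i *m r0 | i <- iota 0 m]>>%VS.

Definition eps_embedding (R : realType) (l n : nat) (eps : R)
    (Om : 'M[R]_(l, n)) (V : {vspace 'cV[R]_n}) : Prop :=
  forall z : 'cV[R]_n, z \in V ->
    (1 - eps) * enorm z ^+ 2 <= enorm (Om *m z) ^+ 2 <= (1 + eps) * enorm z ^+ 2.

(* The sequences x, r, p, gamma, delta are produced by steps 0, ..., K of the
   algorithm started at x0. Their values outside of what these steps compute
   (in particular delta 0) are unconstrained. The conditions _ != 0 say that
   every division performed is a genuine one, x / 0 being 0 in MathComp. *)
Record arCG (R : realType) (l n : nat) (A : 'M[R]_n) (b x0 : 'cV[R]_n)
    (Om : 'M[R]_(l, n)) (K : nat) (x r p : nat -> 'cV[R]_n)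
    (gamma delta : nat -> R) : Prop := ArCG {
  arCG_x0 : x 0%N = x0;
  arCG_r0 : r 0%N = b - A *m x0;
  arCG_p0 : p 0%N = r 0%N;
  arCG_delta_den : forall k : nat, (1 <= k <= K)%N ->
    enorm (Om *m r k.-1) ^+ 2 != 0;
  arCG_delta : forall k : nat, (1 <= k <= K)%N ->
    delta k = enorm (Om *m r k) ^+ 2 / enorm (Om *m r k.-1) ^+ 2;
  arCG_p : forall k : nat, (1 <= k <= K)%N ->
    p k = r k + delta k *: p k.-1;
  arCG_gamma_den : forall k : nat, (k <= K)%N ->
    dot (Om *m (A *m p k)) (Om *m p k) != 0;
  arCG_gamma : forall k : nat, (k <= K)%N ->
    gamma k = enorm (Om *m r k) ^+ 2 / dot (Om *m (A *m p k)) (Om *m p k);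
  arCG_x : forall k : nat, (k <= K)%N ->
    x k.+1 = x k + gamma k *: p k;
  arCG_r : forall k : nat, (k <= K)%N ->
    r k.+1 = r k - gamma k *: (A *m p k)
}.

(* Main.v *)
Require Import Defs.
From mathcomp Require Import all_boot all_order all_algebra.
From mathcomp Require Import reals.
From mathcomp Require Import ring lra.

Set Implicit Arguments.
Unset Strict Implicit.
Unset Printing Implicit Defensive.

Import Order.TTheory GRing.Theory Num.Theory.
Local Open Scope ring_scope.

(** The energy error e_j = x - x_j satisfies A e_j = r_j and
    e_(j+1) = e_j - gamma_j p_j, so one step decreases its squared A-norm by
    gamma_j (2 <r_j, p_j> - gamma_j <A p_j, p_j>).  The claim is the sum of
    bounds on these decrements, and each decrement is compared with
    |gamma_j| |Om p_j|^2 separately.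

    The sketched inner product of the algorithm makes Om r_j exactly orthogonal
    to Om p_(j-1), as in the classical conjugate gradient method
    ([arCG_sketch_orth]).  Write p_j = r_j + q with q = delta_j p_(j-1) (and
    q = 0 when j = 0).  Since Om r_j is orthogonal to Om q, the vectors r_j + q
    and r_j - q have sketches of the same length, and the embedding property
    turns this into 2 |<r_j, q>| <= eps / (1 - eps) |Om p_j|^2
    ([embedding_orth]).  Hence 2 <r_j, p_j> is 2 |r_j|^2 up to this error, while
    the assumption on gamma_j keeps gamma_j <A p_j, p_j> above
    (1 - epst) |r_j|^2; finally |r_j|^2 is at most |Om p_j|^2 / (1 - eps) by the
    embedding property and the Pythagorean theorem for Om p_j
    ([decrement_bound]).  If gamma_j is negative, the decrement equals
    |gamma_j| (gamma_j <A p_j, p_j> - 2 <r_j, p_j>), where the first term is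
    nonpositive and the second is at most the orthogonality error. *)

(** * Euclidean products *)

Section Dot.
Variables (R : realType) (n : nat).
Implicit Types u v w : 'cV[R]_n.

Lemma dotC u v : dot u v = dot v u.
Proof. by apply: eq_bigr => i _; rewrite mulrC. Qed.

Lemma dotDl u v w : dot (u + v) w = dot u w + dot v w.
Proof. by rewrite /dot -big_split; apply: eq_bigr => i _; rewrite mxE mulrDl. Qed.

Lemma dotZl a u v : dot (a *: u) v = a * dot u v.
Proof. by rewrite /dot mulr_sumr; apply: eq_bigr => i _; rewrite mxE mulrA. Qed.

Lemma dotNl u v : dot (- u) v = - dot u v.
Proof. by rewrite -scaleN1r dotZl mulN1r. Qed.

Lemma dot0l v : dot 0 v = 0.
Proof. by rewrite -(scale0r 0) dotZl mul0r. Qed.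

Lemma dotDr u v w : dot w (u + v) = dot w u + dot w v.
Proof. by rewrite dotC dotDl !(dotC w). Qed.

Lemma dotZr a u v : dot v (a *: u) = a * dot v u.
Proof. by rewrite dotC dotZl dotC. Qed.

Lemma dotNr u v : dot v (- u) = - dot v u.
Proof. by rewrite dotC dotNl dotC. Qed.

Lemma dot_ge0 u : 0 <= dot u u.
Proof. by apply: sumr_ge0 => i _; rewrite -expr2 sqr_ge0. Qed.

Lemma sqr_enorm u : enorm u ^+ 2 = dot u u.
Proof. by rewrite /enorm sqr_sqrtr ?dot_ge0. Qed.

End Dot.

Lemma dot_mulmxl (R : realType) (m n : nat) (A : 'M[R]_(m, n)) u v :
  dot (A *m u) v = dot u (A^T *m v).
Proof.
have dotE k (y z : 'cV[R]_k) : dot y z = (y^T *m z) 0 0.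
  by rewrite mxE; apply: eq_bigr => i _; rewrite mxE.
by rewrite !dotE trmx_mul mulmxA.
Qed.

(** * Symmetric positive-definite matrices *)

Lemma sympd_unitmx (R : realType) (n : nat) (A : 'M[R]_n) :
  sympd A -> A \in unitmx.
Proof.
move=> [symA posA]; rewrite -row_free_unit -kermx_eq0.
apply/eqP/row_matrixP => i; rewrite row0.
(* a row of the kernel is a vector annihilated by A, as A is symmetric *)
have /(congr1 trmx) : row i (kermx A) *m A = 0.
  by rewrite -row_mul mulmx_ker row0.
rewrite trmx_mul symA trmx0 => Az0.
apply: trmx_inj; rewrite trmx0; apply/eqP; apply: contraT => /posA.
by rewrite Az0 dot0l ltxx.
Qed.

Lemma sympd_ge0 (R : realType) (n : nat) (A : 'M[R]_n) z :
  sympd A -> 0 <= dot (A *m z) z.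
Proof.
move=> [_ posA]; have [->|/posA/ltW //] := eqVneq z 0.
by rewrite mulmx0 dot0l.
Qed.

Lemma sqnormA_step (R : realType) (n : nat) (A : 'M[R]_n) e p g : sympd A ->
  sqnormA A e - sqnormA A (e - g *: p)
  = g * (2 * dot (A *m e) p - g * dot (A *m p) p).
Proof.
move=> [symA _]; rewrite /sqnormA mulmxBr -scalemxAr.
rewrite !dotDl !dotDr !dotNl !dotNr !dotZl !dotZr.
rewrite (_ : dot (A *m p) e = dot (A *m e) p); first by ring.
by rewrite dot_mulmxl symA dotC.
Qed.

(** * Krylov spaces *)

Section Krylov.
Variables (R : realType) (n : nat) (A : 'M[R]_n) (r0 : 'cV[R]_n).

Lemma krylov_leq m m' : (m <= m')%N -> (krylov A r0 m <= krylov A r0 m')%VS.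
Proof.
move=> lemm'; apply: sub_span => _ /mapP[i + ->].
rewrite mem_iota => /andP[_ ltim]; apply/mapP; exists i => //.
by rewrite mem_iota /= (leq_trans ltim lemm').
Qed.

Lemma krylov_start : r0 \in krylov A r0 1.
Proof. by apply: memv_span; rewrite /= expr0 mul1mx mem_head. Qed.

Lemma krylov_mulmx m z : z \in krylov A r0 m -> A *m z \in krylov A r0 m.+1.
Proof.
move=> /(memv_img (linfun (mulmx A))); rewrite lfunE limg_span; apply/subvP.
apply/span_subvP => _ /mapP[_ /mapP[i + ->] ->].
rewrite mem_iota => /andP[_ ltim]; apply: memv_span; apply/mapP.
exists i.+1; first by rewrite mem_iota.
by rewrite lfunE /= mulmxA exprS.
Qed.

End Krylov.

(** * One step of the algorithm *)

Section Embedding.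
Variables (R : realType) (l n : nat) (eps : R) (Om : 'M[R]_(l, n)).
Variable V : {vspace 'cV[R]_n}.
Hypotheses (eps01 : 0 < eps < 1) (embOm : eps_embedding eps Om V).

(** The vectors u + v and u - v have sketches of the same length s, so their
    squared lengths both lie between s^2 / (1 + eps) and s^2 / (1 - eps), and
    they differ by 4 <u, v>. *)
Lemma embedding_orth u v : u \in V -> v \in V ->
  dot (Om *m u) (Om *m v) = 0 ->
  `|(1 - eps) * (2 * dot u v)| <= eps * enorm (Om *m (u + v)) ^+ 2.
Proof.
move=> uV vV uv0.
have := embOm (memvD uV vV); have := embOm (memvB uV vV).
rewrite !sqr_enorm mulmxBr mulmxDr !(dotDl, dotDr, dotNl, dotNr).
rewrite (dotC v u) (dotC (Om *m v)) uv0.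
move: (dot u u) (dot v v) (dot u v) (dot (Om *m u) _) (dot (Om *m v) _).
move=> uu vv uv suu svv /andP[lo1 up1] /andP[lo2 up2].
have /andP[eps_gt0 eps_lt1] := eps01.
have avg : eps * ((1 - eps) * (uu + vv)) <= eps * (suu + svv).
  by rewrite ler_pM2l //; lra.
have lo3 : - (eps * (uu + vv)) <= 2 * uv by lra.
have up3 : 2 * uv <= eps * (uu + vv) by lra.
have c_gt0 : 0 < 1 - eps by lra.
have up4 := ler_wpM2l (ltW c_gt0) up3.
have lo4 := ler_wpM2l (ltW c_gt0) lo3.
rewrite ler_norml; apply/andP; split; lra.
Qed.

(** The case analysis on the sign of g is forced by [epst] being possibly larger
    than 1.  For g >= 0 the hypothesis on g c leaves (1 + epst) |w|^2 + 2 <w, q>;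
    for g < 0 the factor of |g| is g c - 2 |w|^2 - 2 <w, q>, at most
    - 2 <w, q>.  In a conjugate gradient step, w is the residual, w + q the
    search direction, g the step length and c the squared energy norm of
    w + q. *)
Lemma decrement_bound (epst g c : R) w q : w \in V -> q \in V ->
  dot (Om *m w) (Om *m q) = 0 -> 0 < epst -> 0 <= c ->
  (1 - epst) * enorm w ^+ 2 <= g * c ->
  g * (2 * dot w (w + q) - g * c)
  <= (1 + epst + 2 * eps) / (1 - eps) * (`|g| * enorm (Om *m (w + q)) ^+ 2).
Proof.
move=> wV qV wq0 epst_gt0 c_ge0 lo_g.
have /andP[eps_gt0 eps_lt1] := eps01.
have cpl_gt0 : 0 < 1 - eps by lra.
have := embedding_orth wV qV wq0; have /andP[emb_w _] := embOm wV.
have pyth : enorm (Om *m w) ^+ 2 <= enorm (Om *m (w + q)) ^+ 2.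
  rewrite mulmxDr !sqr_enorm !dotDl !dotDr (dotC (Om *m q)) wq0.
  by have := dot_ge0 (Om *m q); lra.
have := sqr_ge0 (enorm w).
move: emb_w pyth lo_g; rewrite dotDr -(sqr_enorm w).
move: (enorm w ^+ 2) (enorm (Om *m w) ^+ 2) (enorm (Om *m (w + q)) ^+ 2).
move=> ww sw sp emb_w pyth lo_g ww_ge0; move: (dot w q) => wq.
rewrite ler_norml => /andP[lo_wq up_wq].
have sp_ge0 : 0 <= sp.
  have : 0 <= (1 - eps) * ww by rewrite mulr_ge0 // ltW.
  by lra.
have eps_sp : 0 <= eps * sp by rewrite mulr_ge0 // ltW.
have epst_sp : 0 <= epst * sp by rewrite mulr_ge0 // ltW.
have -> : (1 + epst + 2 * eps) / (1 - eps) * (`|g| * sp)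
          = `|g| * ((1 + epst + 2 * eps) * sp / (1 - eps)) by ring.
have [g_ge0|g_lt0] := leP 0 g.
  rewrite ger0_norm //; apply: ler_wpM2l => //.
  rewrite ler_pdivlMr //.
  have t_gt0 : 0 < 1 + epst by lra.
  have b1 := ler_wpM2l (ltW t_gt0) (le_trans emb_w pyth).
  have b2 := ler_wpM2l (ltW cpl_gt0) lo_g.
  by lra.
rewrite ltr0_norm // -[leLHS]mulrNN; apply: ler_wpM2l.
  by rewrite oppr_ge0 ltW.
rewrite ler_pdivlMr //.
have gc_le0 : g * c <= 0 by rewrite mulr_le0_ge0 // ltW.
have b1 := mulr_ge0_le0 (ltW cpl_gt0) gc_le0.
have b2 := mulr_ge0 (ltW cpl_gt0) ww_ge0.
by lra.
Qed.

End Embedding.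

(** * Invariants of the algorithm *)

Section Invariants.
Variables (R : realType) (l n : nat) (A : 'M[R]_n) (b x0 : 'cV[R]_n).
Variables (Om : 'M[R]_(l, n)) (K : nat) (x r p : nat -> 'cV[R]_n).
Variables (gamma delta : nat -> R).
Hypothesis run : arCG A b x0 Om K x r p gamma delta.

Lemma arCG_residual k : (k <= K.+1)%N -> r k = b - A *m x k.
Proof.
elim: k => [|k IHk] leK; first by rewrite (arCG_r0 run) (arCG_x0 run).
rewrite (arCG_r run leK) (arCG_x run leK) IHk 1?ltnW //.
by rewrite mulmxDr -scalemxAr opprD addrA.
Qed.

Lemma arCG_krylov k : (k <= K)%N ->
  r k \in krylov A (b - A *m x0) k.+1 /\ p k \in krylov A (b - A *m x0) k.+1.
Proof.
elim: k => [|k IHk] leK.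
  by rewrite (arCG_p0 run) (arCG_r0 run) krylov_start.
have [rV pV] := IHk (ltnW leK).
have up := subvP (krylov_leq A (b - A *m x0) (leqnSn k.+1)).
have rV1 : r k.+1 \in krylov A (b - A *m x0) k.+2.
  rewrite (arCG_r run (ltnW leK)).
  by apply: memvB; [exact: up | apply/memvZ/krylov_mulmx].
by split=> //; rewrite (arCG_p run (k := k.+1) leK); apply: memvD => //; apply/memvZ/up.
Qed.

(** The coefficient gamma_k is chosen so that Om r_(k+1) is orthogonal to
    Om p_k as soon as <Om r_k, Om p_k> = |Om r_k|^2, and this orthogonality
    gives the same identity at k + 1.  The identity starts the induction since
    p_0 = r_0. *)
Lemma arCG_sketch_identity k : (k <= K)%N ->
  dot (Om *m r k) (Om *m p k) = enorm (Om *m r k) ^+ 2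
  /\ dot (Om *m r k.+1) (Om *m p k) = 0.
Proof.
have orth i : (i <= K)%N ->
    dot (Om *m r i) (Om *m p i) = enorm (Om *m r i) ^+ 2 ->
    dot (Om *m r i.+1) (Om *m p i) = 0.
  move=> leK idi; rewrite (arCG_r run leK) mulmxBr -scalemxAr.
  rewrite dotDl dotNl dotZl idi (arCG_gamma run leK).
  by rewrite divfK ?subrr // (arCG_gamma_den run leK).
elim: k => [|k IHk] leK.
  have id0 : dot (Om *m r 0%N) (Om *m p 0%N) = enorm (Om *m r 0%N) ^+ 2.
    by rewrite (arCG_p0 run) sqr_enorm.
  by split=> //; apply: orth.
have [_ orthk] := IHk (ltnW leK).
have idk1 : dot (Om *m r k.+1) (Om *m p k.+1) = enorm (Om *m r k.+1) ^+ 2.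
  by rewrite (arCG_p run (k := k.+1) leK) mulmxDr -scalemxAr dotDr dotZr orthk mulr0 addr0
             sqr_enorm.
by split=> //; apply: orth.
Qed.

Lemma arCG_sketch_orth k : (k <= K)%N ->
  dot (Om *m r k) (Om *m (p k - r k)) = 0.
Proof.
move=> /arCG_sketch_identity[idk _].
by rewrite mulmxBr dotDr dotNr idk sqr_enorm subrr.
Qed.

End Invariants.

Theorem proposition4p2 (R : realType) (n l : nat) (A : 'M[R]_n)
    (b x0 : 'cV[R]_n) (Om : 'M[R]_(l, n)) (kmax : nat) (eps epst : R)
    (x r p : nat -> 'cV[R]_n) (gamma delta : nat -> R) :
  sympd A ->
  (0 < kmax)%N ->
  0 < eps < 1 ->
  eps_embedding eps Om (krylov A (b - A *m x0) kmax) ->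
  arCG A b x0 Om kmax x r p gamma delta ->
  0 < epst ->
  (forall k : nat, (k <= kmax)%N ->
    (1 - epst) * (enorm (r k) ^+ 2 / dot (p k) (A *m p k)) <= gamma k
      <= (1 + epst) * (enorm (r k) ^+ 2 / dot (p k) (A *m p k))) ->
  (forall k : nat, (1 <= k <= kmax)%N ->
    (1 - epst) * (enorm (r k) ^+ 2 / enorm (r k.-1) ^+ 2) <= delta k
      <= (1 + epst) * (enorm (r k) ^+ 2 / enorm (r k.-1) ^+ 2)) ->
  forall k d : nat, (k + d <= kmax)%N ->
    sqnormA A (invmx A *m b - x k) - sqnormA A (invmx A *m b - x (k + d)%N)
    <= (1 + epst + 2 * eps) / (1 - eps)
       * \sum_(k <= j < k + d) `|gamma j| * enorm (Om *m p j) ^+ 2.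
Proof.
move=> spdA _ eps01 embOm run epst_gt0 gammaP _ k d lekd.
rewrite mulr_sumr.
have -> : sqnormA A (invmx A *m b - x k)
    - sqnormA A (invmx A *m b - x (k + d)%N)
  = \sum_(k <= j < k + d) (sqnormA A (invmx A *m b - x j)
      - sqnormA A (invmx A *m b - x j.+1)).
  rewrite -[LHS]opprB.
  rewrite -(telescope_sumr (fun j => sqnormA A (invmx A *m b - x j))
                           (leq_addr d k)).
  by rewrite -sumrN; apply: eq_bigr => j _; rewrite opprB.
apply: ler_sum_nat => j /andP[_ ltj].
have ltjK : (j < kmax)%N := leq_trans ltj lekd.
have lejK := ltnW ltjK.
have [rV pV] := arCG_krylov run lejK.
have up := subvP (krylov_leq A (b - A *m x0) ltjK).
have Ae : A *m (invmx A *m b - x j) = r j.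
  rewrite mulmxBr mulKVmx ?sympd_unitmx //.
  by rewrite (arCG_residual run) // (leq_trans lejK).
have -> : invmx A *m b - x j.+1 = invmx A *m b - x j - gamma j *: p j.
  by rewrite (arCG_x run lejK) opprD addrA.
rewrite sqnormA_step // Ae.
have pE : p j = r j + (p j - r j) by rewrite addrC subrK.
(* the nonzero denominator of gamma j forces p j != 0 *)
have pAp_gt0 : 0 < dot (A *m p j) (p j).
  apply: spdA.2; apply: contraNneq (arCG_gamma_den run lejK) => ->.
  by rewrite !mulmx0 dot0l.
have lo_g : (1 - epst) * enorm (r j) ^+ 2 <= gamma j * dot (A *m p j) (p j).
  have /andP[+ _] := gammaP j lejK.
  by rewrite (dotC (p j)) mulrA ler_pdivrMr.
rewrite [X in dot (r j) X]pE [X in Om *m X]pE.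
apply: (decrement_bound eps01 embOm) => //; last exact: ltW.
- exact: up.
- by rewrite memvB // up.
- exact: (arCG_sketch_orth run).
Qed.
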